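(* Let $r,s\ge0$ be integers, $n=r+s+2$, and \[ \mathbf a=(1,\underbrace{0,\dots,0}_{r},1,\underbrace{0,\dots,0}_{s},-2)\in\mathbb{Z}^{n+1}. \] Then the number of vertices of the flow polytope $\mathcal{F}_{K_{n+1}}(\mathbf a)$ is $2^{r+1}3^s$.
   Context: $K_{n+1}$ is the complete graph on $[n+1]$ with one edge $(i,j)$ for each $1\le i<j\le n+1$. For an integer vector $\mathbf a=(a_1,\dots,a_{n+1})$ with entries summing to $0$, the flow polytope $\mathcal{F}_{K_{n+1}}(\mathbf a)\subset\mathbb{R}^{\binom{n+1}2}$ is the set of nonnegative real weightings $(f_{ij})_{i<j}$ of the edges such that for each vertex $i$, $\sum_{g<i}f_{gi}+a_i=\sum_{j>i}f_{ij}$. *)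

(* Defs.v *)
From mathcomp Require Import all_boot all_order all_algebra.
From mathcomp Require Import all_classical all_reals.

Set Implicit Arguments.
Unset Strict Implicit.
Unset Printing Implicit Defensive.

Import Order.TTheory GRing.Theory Num.Theory.

Local Open Scope classical_set_scope.
Local Open Scope ring_scope.

(* The vertices 1, ..., n+1 of K_{n+1} are represented by 0, ..., n. *)
Definition edge (n : nat) : Type :=
  {e : 'I_n.+1 * 'I_n.+1 | (e.1 < e.2)%N}.

Definition tail (n : nat) (e : edge n) : 'I_n.+1 := (val e).1.

Definition head (n : nat) (e : edge n) : 'I_n.+1 := (val e).2.

Definition flow_polytope (R : realType) (n : nat) (a : 'I_n.+1 -> int) :
    set {ffun edge n -> R} :=
  [set f | (forall e : edge n, 0 <= f e) /\
           (forall i : 'I_n.+1,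
              \sum_(e : edge n | head e == i) f e + (a i)%:~R =
              \sum_(e : edge n | tail e == i) f e)].

Arguments flow_polytope R {n} a.

Definition dot (R : realType) (E : finType) (c x : {ffun E -> R}) : R :=
  \sum_(e : E) c e * x e.

(* F is the set of points of P where a linear inequality valid on P is tight;
   c = 0 is allowed, so that P itself and the empty set are faces. *)
Definition is_face (R : realType) (E : finType) (P F : set {ffun E -> R}) :
    Prop :=
  exists (c : {ffun E -> R}) (b : R),
    (forall x, P x -> dot c x <= b) /\ F = P `&` [set x | dot c x = b].

(* The zero-dimensional faces of P, identified with their unique point. *)
Definition vertices (R : realType) (E : finType) (P : set {ffun E -> R}) :
    set {ffun E -> R} :=
  [set v | is_face P [set v]].

Definition netflow_seq (r s : nat) : seq int :=
  [:: 1] ++ nseq r 0 ++ [:: 1] ++ nseq s 0 ++ [:: - 2%:Z].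

Lemma size_netflow_seq (r s : nat) : size (netflow_seq r s) = (r + s + 2).+1.
Proof.
by rewrite /netflow_seq !size_cat !size_nseq /= !addnS !addn0 addSn.
Qed.

Definition netflow (r s : nat) (i : 'I_(r + s + 2).+1) : int :=
  nth 0 (netflow_seq r s) i.

Arguments netflow : clear implicits.

Lemma sum_netflow (r s : nat) : \sum_i netflow r s i = 0.
Proof.
have -> : \sum_i netflow r s i = \sum_(x <- netflow_seq r s) x.
  by rewrite [RHS](big_nth 0) size_netflow_seq big_mkord.
rewrite /netflow_seq !big_cat /= !big_nseq !big_seq1.
by rewrite !iter_addr_0 !mul0rn.
Qed.

(* Main.v *)
(* A point of the polytope is a vertex exactly when at most one edge of its
   support leaves each vertex of the graph: two support edges with a common
   tail extend, inside the support, to two unit flows into the sink, whose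
   difference is a circulation along which the point can be moved both ways;
   conversely a flow is determined by such a support.  In these flows vertex 0
   sends its whole supply along one edge, so removing vertex 0 and adding its
   supply to the chosen target gives a recursion for their number.  The
   recursion yields 2^(N-1-p) for a single source p before the sink N, and
   2^(q-p) * 3^(N-1-q) for two sources p < q. *)
Require Import Defs.
From mathcomp Require Import all_boot all_order all_algebra.
From mathcomp Require Import all_classical all_reals.
From mathcomp Require Import finmap ring lra zify.

Set Implicit Arguments.
Unset Strict Implicit.
Unset Printing Implicit Defensive.

Import Order.TTheory GRing.Theory Num.Theory.

Local Open Scope classical_set_scope.
Local Open Scope card_scope.
Local Open Scope ring_scope.

(* [seq.head] shadows the endpoint map of edges. *)
Local Notation head := Defs.head.

(** * Nonbranching flows as matrices, and their recursive enumeration *)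

(** Flows are matrices indexed by all naturals and zero off the edges: deleting a vertex then
    changes no type, and equality of flows is equality of functions. *)
Definition tree_flow (R : numDomainType) (N : nat) (a : nat -> R)
    (F : nat -> nat -> R) : Prop :=
  [/\ forall i j, 0 <= F i j,
      forall i j, ~~ (i < j <= N)%N -> F i j = 0,
      forall i, (i <= N)%N ->
        \sum_(g < N.+1) F g i + a i = \sum_(j < N.+1) F i j
    & forall i j k, F i j != 0 -> F i k != 0 -> j = k].

(** Puts a new vertex 0 in front of [F]. The target [j] is numbered as in [F], so it becomes vertex
    [j.+1]. *)
Definition cons_flow (R : numDomainType) (j : nat) (x : R)
    (F : nat -> nat -> R) : nat -> nat -> R :=
  fun i k => match i, k with
             | i'.+1, k'.+1 => F i' k'
             | 0%N, k'.+1 => if k' == j then x else 0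
             | _, _ => 0
             end.

Definition push_supply (R : numDomainType) (a : nat -> R) (j : nat) :
    nat -> R :=
  fun i => a i.+1 + (if i == j then a 0%N else 0).

(* The supply [a N] of the sink is ignored. A vertex without supply sends
   nothing, so its target is irrelevant and must not be counted. *)
Fixpoint enum_flows (R : numDomainType) (N : nat) (a : nat -> R) :
    seq (nat -> nat -> R) :=
  if N is N'.+1 then
    if a 0%N == 0 then
      [seq cons_flow 0 0 F | F <- enum_flows N' (fun i => a i.+1)]
    else [seq cons_flow j (a 0%N) F
         | j <- iota 0 N, F <- enum_flows N' (push_supply a j)]
  else [:: fun _ _ => 0].

Lemma enum_flowsS (R : numDomainType) (N : nat) (a : nat -> R) :
  enum_flows N.+1 a =
    if a 0%N == 0 then
      [seq cons_flow 0 0 F | F <- enum_flows N (fun i => a i.+1)]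
    else [seq cons_flow j (a 0%N) F
         | j <- iota 0 N.+1, F <- enum_flows N (push_supply a j)].
Proof. by []. Qed.

Lemma cons_flow_inj (R : numDomainType) (j : nat) (x : R) :
  injective (cons_flow j x).
Proof.
move=> F G FG; apply/funext => i; apply/funext => k.
by have := congr1 (fun H => H i.+1 k.+1) FG.
Qed.

Lemma uniq_enum_flows (R : numDomainType) (N : nat) (a : nat -> R) :
  uniq (enum_flows N a).
Proof.
elim: N a => [//|N IHN] a; rewrite enum_flowsS; case: eqP => [_|/eqP a0].
  by rewrite map_inj_uniq //; exact: cons_flow_inj.
apply: allpairs_uniq_dep => [|j _|]; [exact: iota_uniq|exact: IHN|].
move=> [j F] [k G] _ _ /= FG.
(* Entry [(0, j.+1)] is [a 0] in the first flow, but would be 0 in the second if the targets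
   differed. *)
have jk : j = k.
  have := congr1 (fun H => H 0%N j.+1) FG.
  by rewrite /= eqxx; case: eqP => // _ /eqP; rewrite (negPf a0).
by rewrite -jk in FG *; rewrite (cons_flow_inj FG).
Qed.

(** What vertex 0 sends to its target counts there either as inflow or as extra supply; the balance
    is the same. *)
Lemma tree_flow_cons (R : numDomainType) (N : nat) (a : nat -> R) (j : nat)
    (F : nat -> nat -> R) :
  0 <= a 0%N -> (j <= N)%N ->
  tree_flow N.+1 a (cons_flow j (a 0%N) F) <-> tree_flow N (push_supply a j) F.
Proof.
move=> a0 jN.
have inflow i : \sum_(g < N.+2) cons_flow j (a 0%N) F g i.+1 + a i.+1 =
    \sum_(g < N.+1) F g i + push_supply a j i.
  rewrite big_ord_recl /= /push_supply; set y := (if _ then _ else _).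
  by rewrite addrAC addrC addrA (addrC (a _)) addrA.
have outflow i : \sum_(k < N.+2) cons_flow j (a 0%N) F i.+1 k =
    \sum_(k < N.+1) F i k by rewrite big_ord_recl /= add0r.
split=> [[F0 F1 F2 F3]|[F0 F1 F2 F3]]; split.
- by move=> i k; exact: (F0 i.+1 k.+1).
- by move=> i k ik; apply: (F1 i.+1 k.+1).
- by move=> i iN; rewrite -inflow -outflow; apply: F2.
- by move=> i k l Fk Fl; case: (F3 i.+1 k.+1 l.+1 Fk Fl).
- by move=> [|i] [|k] //=; case: ifP.
- move=> [|i] [|k] //= ik; last exact: F1.
  by case: eqP => // kj; rewrite kj ltnS jN in ik.
- move=> [|i] iN; last by rewrite inflow outflow F2.
  rewrite big1 => [|[[|g] gN] _ //]; rewrite add0r big_ord_recl /= add0r.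
  rewrite (bigD1 (Ordinal (jN : (j < N.+1)%N))) //= eqxx big1 ?addr0 // => k.
  by rewrite -val_eqE /= => /negPf ->.
- move=> [|i] [|k] [|l] //=; try by rewrite eqxx.
    by case: (k =P j) => [->|_]; case: (l =P j) => [->|_]; rewrite ?eqxx.
  by move=> Fk Fl; rewrite (F3 _ _ _ Fk Fl).
Qed.

(** Row 0 has at most one nonzero entry, and since nothing enters vertex 0, balance forces that
    entry to be [a 0]. *)
Lemma tree_flow_uncons (R : numDomainType) (N : nat) (a : nat -> R)
    (F : nat -> nat -> R) :
  tree_flow N.+1 a F -> exists j G, (j <= N)%N /\ F = cons_flow j (a 0%N) G.
Proof.
case=> F0 F1 F2 F3.
have outflow : a 0%N = \sum_(k < N.+1) F 0%N k.+1.
  have := F2 0%N isT; rewrite [in RHS]big_ord_recl F1 // add0r.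
  by rewrite big1 ?add0r // => g _; rewrite F1 // ltn0.
have [j jN Fj] : exists2 j, (j <= N)%N &
    forall k, F 0%N k.+1 = if k == j then a 0%N else 0.
  have [a0|a0] := eqVneq (a 0%N) 0.
    (* Nonnegative entries with sum 0 all vanish, so any target would do. *)
    exists 0%N => // k; rewrite a0 if_same.
    have [kN|kN] := leqP k N; last by rewrite F1 //; lia.
    have sum0 : \sum_(k < N.+1) F 0%N k.+1 = 0 by rewrite -outflow.
    have kN1 : (k < N.+1)%N by [].
    by move/psumr_eq0P: sum0 => /(_ (fun _ _ => F0 _ _) (Ordinal kN1) isT).
  have [j Fj] : exists j : 'I_N.+1, F 0%N j.+1 != 0.
    apply/existsP; apply: contra_neqT a0 => /existsPn Fz.
    by rewrite outflow big1 // => k _; apply/eqP; rewrite -[_ == _]negbK.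
  have Fz (k : nat) : k != j -> F 0%N k.+1 = 0.
    by apply: contra_neq_eq => Fk; case: (F3 _ _ _ Fk Fj).
  exists j; first by case: j {Fj Fz}.
  move=> k; case: eqP => [->|/eqP /Fz //].
  by rewrite outflow (bigD1 j) //= big1 ?addr0 // => i ij; rewrite Fz.
exists j, (fun i k => F i.+1 k.+1); split=> //.
apply/funext => -[|i]; apply/funext => -[|k] //=; exact: F1.
Qed.

Lemma sum_push_supply (R : numDomainType) (N : nat) (a : nat -> R) (j : nat) :
  (j <= N)%N ->
  \sum_(i < N.+1) push_supply a j i = \sum_(i < N.+2) a i.
Proof.
move=> jN; rewrite [RHS]big_ord_recl /= /push_supply big_split /= addrC.
congr (_ + _); rewrite (bigD1 (Ordinal (jN : (j < N.+1)%N))) //= eqxx.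
by rewrite big1 ?addr0 // => k; rewrite -val_eqE /= => /negPf ->.
Qed.

Lemma push_supply_ge0 (R : numDomainType) (N : nat) (a : nat -> R) (j : nat) :
  (forall i, (i < N.+1)%N -> 0 <= a i) ->
  forall i, (i < N)%N -> 0 <= push_supply a j i.
Proof.
move=> a0 i iN; rewrite addr_ge0 ?a0 //.
by case: ifP => // _; rewrite a0.
Qed.

Lemma push_supply0 (R : numDomainType) (a : nat -> R) (j : nat) :
  a 0%N = 0 -> push_supply a j = fun i => a i.+1.
Proof.
by move=> a0; apply/funext => i; rewrite /push_supply a0 if_same addr0.
Qed.

(** Induction on [N], deleting vertex 0. Total supply 0 survives each deletion and is exactly the
    balance condition left at the sink when [N] is 0. *)
Lemma mem_enum_flows (R : numDomainType) (N : nat) (a : nat -> R)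
    (F : nat -> nat -> R) :
  (forall i, (i < N)%N -> 0 <= a i) -> \sum_(i < N.+1) a i = 0 ->
  F \in enum_flows N a <-> tree_flow N a F.
Proof.
elim: N a F => [|N IHN] a F a_ge0 a_sum.
  rewrite inE; split=> [/eqP ->|[_ F1 _ _]].
    split=> // [i|i j k]; last by rewrite eqxx.
    by case: i => // _; rewrite !big_ord1 add0r in a_sum *.
  apply/eqP/funext => i; apply/funext => j; apply: F1; lia.
have a00 : 0 <= a 0%N by exact: a_ge0.
have IH j G : (j <= N)%N ->
    (G \in enum_flows N (push_supply a j) <-> tree_flow N (push_supply a j) G).
  move=> jN; apply: IHN; last by rewrite sum_push_supply.
  exact: push_supply_ge0.
rewrite enum_flowsS; case: eqP => [a0|a0].
  split.
    move=> /mapP[G]; rewrite -(push_supply0 0 a0) => /IH G_flow ->.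
    rewrite -[X in cons_flow _ X]a0; apply/tree_flow_cons => //.
    exact: G_flow.
  move=> F_flow; have [j [G [jN FE]]] := tree_flow_uncons F_flow.
  move: F_flow; rewrite FE => /(tree_flow_cons _ a00 jN)/(IH _ _ jN).
  rewrite push_supply0 // => GN; apply/mapP; exists G => //.
  (* With zero supply row 0 vanishes whatever [j] is, so target 0 gives the same flow. *)
  apply/funext => -[|i]; apply/funext => -[|k] //=.
  by rewrite a0 !if_same.
split.
  move=> /allpairsPdep[j [G [jN GN ->]]]; rewrite mem_iota in jN.
  by apply/tree_flow_cons => //; apply/IH.
move=> F_flow; have [j [G [jN FE]]] := tree_flow_uncons F_flow.
move: F_flow; rewrite FE => /(tree_flow_cons _ a00 jN)/(IH _ _ jN) GN.
by apply/allpairsPdep; exists j, G; split; rewrite // mem_iota.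
Qed.

(** * Counting the enumerated flows *)

Lemma eq_enum_flows (R : numDomainType) (N : nat) (a b : nat -> R) :
  (forall i, (i < N)%N -> a i = b i) -> enum_flows N a = enum_flows N b.
Proof.
elim: N a b => [//|N IHN] a b ab; rewrite !enum_flowsS ab //.
have -> : enum_flows N (fun i => a i.+1) = enum_flows N (fun i => b i.+1).
  by apply: IHN => i iN; exact: ab.
case: eqP => // _; congr flatten; apply: eq_map => j; congr map.
by apply: IHN => i iN; rewrite /push_supply !ab.
Qed.

Lemma size_enum_flowsS (R : numDomainType) (N : nat) (a : nat -> R) :
  size (enum_flows N.+1 a) =
    if a 0%N == 0 then size (enum_flows N (fun i => a i.+1))
    else (\sum_(j < N.+1) size (enum_flows N (push_supply a j)))%N.
Proof.
rewrite enum_flowsS; case: eqP => _; first by rewrite size_map.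
by rewrite size_allpairs_dep sumnE big_map -/(index_iota 0 N.+1) big_mkord.
Qed.

Definition point_supply (R : numDomainType) (p : nat) (x : R) : nat -> R :=
  fun i => if i == p then x else 0.

Definition two_supply (R : numDomainType) (p q : nat) (x y : R) : nat -> R :=
  fun i => point_supply p x i + point_supply q y i.

Lemma sum_exp2 (n : nat) : (\sum_(i < n) 2 ^ i).+1 = (2 ^ n)%N.
Proof.
elim: n => [|n IHn]; first by rewrite big_ord0.
by rewrite big_ord_recr -addSn IHn addnn expnS mul2n.
Qed.

(** The factorisation of [3 ^ n - 2 ^ n] by [3 - 2 = 1], written without subtraction. *)
Lemma sum_exp2_exp3 (n : nat) :
  (\sum_(i < n) 2 ^ i * 3 ^ (n.-1 - i) + 2 ^ n)%N = (3 ^ n)%N.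
Proof.
elim: n => [|n IHn]; first by rewrite big_ord0.
rewrite big_ord_recl subn0 mul1n -[n.+1.-1]/n.
under eq_bigr => i _.
  rewrite /= /bump /= add1n expnS -mulnA.
  have -> : (n - i.+1 = n.-1 - i)%N by lia.
over.
rewrite -big_distrr /= !expnS -IHn.
by move: (\sum_(i < n) _)%N (2 ^ n)%N => S T; lia.
Qed.

(* If [N <= p] all the [N] supplies vanish, and the truncated exponent is 0. *)
Lemma size_enum_point (R : numDomainType) (N p : nat) (x : R) :
  x != 0 -> size (enum_flows N (point_supply p x)) = (2 ^ (N.-1 - p))%N.
Proof.
move=> x0; elim: N p => [|N IHN] [|p] //; rewrite size_enum_flowsS /=.
  (* The last target [N] is the sink and contributes 1; the other targets contribute the powers of 2
     below [2 ^ N], each once. *)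
  rewrite {1}/point_supply /= (negPf x0) big_ord_recr /=.
  rewrite (@eq_enum_flows _ _ _ (point_supply N x)) => [|i iN]; last first.
    by rewrite /push_supply /point_supply /= add0r.
  rewrite IHN subn0.
  under eq_bigr => j _.
    rewrite (@eq_enum_flows _ _ _ (point_supply j x)) => [|i iN]; last first.
      by rewrite /push_supply /point_supply /= add0r.
    rewrite IHN.
  over.
  rewrite -[in RHS]sum_exp2 (reindex_inj rev_ord_inj) /=.
  have -> : (N.-1 - N = 0)%N by lia.
  rewrite expn0 addn1; congr _.+1; apply: eq_bigr => i _; congr (2 ^ _)%N.
  by case: i => i /= iN; lia.
rewrite {1}/point_supply eqxx (IHN p) ; congr (2 ^ _)%N; lia.
Qed.

Lemma two_supplyC (R : numDomainType) (p q : nat) (x y : R) :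
  two_supply p q x y = two_supply q p y x.
Proof. by apply/funext => i; rewrite /two_supply addrC. Qed.

Lemma push_two_supply (R : numDomainType) (q j : nat) (x y : R) :
  push_supply (two_supply 0 q.+1 x y) j = two_supply j q x y.
Proof.
apply/funext => i.
by rewrite /push_supply /two_supply /point_supply /= add0r addr0 addrC eqSS.
Qed.

Lemma two_supply_diag (R : numDomainType) (p : nat) (x y : R) :
  two_supply p p x y = point_supply p (x + y).
Proof.
apply/funext => i; rewrite /two_supply /point_supply.
by case: eqP; rewrite ?addr0.
Qed.

(** For [p] = 0, split by the target of vertex 0: before the other source there are again two
    sources, on it they merge into one, beyond it they exchange order, and at the sink one source
    remains. Positivity keeps merged supplies from cancelling. *)
Lemma size_enum_two (R : numDomainType) (N p q : nat) (x y : R) :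
  0 < x -> 0 < y -> (p < q < N)%N ->
  size (enum_flows N (two_supply p q x y)) = (2 ^ (q - p) * 3 ^ (N.-1 - q))%N.
Proof.
elim: N p q x y => [|N IHN] p q x y x0 y0; first by lia.
case: q => [|q]; first by lia.
rewrite ltnS => /andP[pq qN]; rewrite size_enum_flowsS.
case: p pq => [|p] pq; last first.
  rewrite {1}/two_supply /point_supply /= addr0 eqxx IHN //; last by lia.
  by congr (_ * 3 ^ _)%N; lia.
rewrite {1}/two_supply /point_supply /= addr0 gt_eqF //.
under eq_bigr do rewrite push_two_supply.
pose c j := size (enum_flows N (two_supply j q x y)).
rewrite -[LHS]/(\sum_(j < N.+1) c j)%N.
(* [m] counts the vertices strictly between the second source and the sink. *)
have [m NE] : exists m, N = (q + m).+1 by exists (N - q.+1)%N; lia.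
have c_lt j : (j < q)%N -> c j = (2 ^ (q - j) * 3 ^ m)%N.
  by move=> jq; rewrite /c IHN ?jq //; congr (_ * 3 ^ _)%N; lia.
have c_eq : c q = (2 ^ m)%N.
  rewrite /c two_supply_diag size_enum_point ?gt_eqF ?addr_gt0 //.
  by congr (2 ^ _)%N; lia.
have c_gt k : (k < m)%N -> c (q + k.+1)%N = (2 ^ k.+1 * 3 ^ (m.-1 - k))%N.
  move=> km; rewrite /c two_supplyC IHN //; last by lia.
  by congr (2 ^ _ * 3 ^ _)%N; lia.
(* The supply [x] now sits at the sink, where [enum_flows] does not look. *)
have c_last : c N = (2 ^ m)%N.
  rewrite /c (@eq_enum_flows _ _ _ (point_supply q y)) => [|i iN]; last first.
    by rewrite /two_supply /point_supply ltn_eqF ?add0r.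
  by rewrite size_enum_point ?gt_eqF //; congr (2 ^ _)%N; lia.
have -> : (N.+1.-1 - q.+1 = m)%N by lia.
rewrite NE -!addnS big_split_ord big_ord_recl big_ord_recr /= addn0 c_eq.
rewrite /bump /= add1n addnS -NE c_last.
have -> : (\sum_(i < q) c i = 2 * (\sum_(i < q) 2 ^ i) * 3 ^ m)%N.
  rewrite (reindex_inj rev_ord_inj) /= big_distrr big_distrl /=.
  apply: eq_bigr => i _; case: i => i /= iq.
  rewrite c_lt; last by lia.
  by rewrite -expnS; congr (2 ^ _ * _)%N; lia.
have -> : (\sum_(i < m) c (q + bump 0 i) =
           2 * \sum_(i < m) 2 ^ i * 3 ^ (m.-1 - i))%N.
  rewrite big_distrr /=; apply: eq_bigr => i _.
  by rewrite /bump add1n c_gt // expnS mulnA.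
(* With the names introduced next, the claim is [2 * A * D + 2 * B + 2 * C = 2 * A.+1 * D], where
   [D = B + C]. *)
rewrite subn0 expnS -(sum_exp2 q); have := sum_exp2_exp3 m.
move: (\sum_(i < q) _)%N (\sum_(i < m) _)%N (2 ^ m)%N (3 ^ m)%N => A B C D <-.
nia.
Qed.

(** * Translation between edge functions and matrices *)

Definition nonbranching (R : realType) (n : nat) (f : {ffun edge n -> R}) :
    Prop :=
  forall e e' : edge n, f e != 0 -> f e' != 0 -> tail e = tail e' -> e = e'.

Definition restrict (R : realType) (n : nat) (F : nat -> nat -> R) :
    {ffun edge n -> R} :=
  [ffun e => F (tail e) (head e)].

(** At most one edge satisfies the condition; writing a sum yields 0 off the edges without a case
    split. *)
Definition extend (R : realType) (n : nat) (f : {ffun edge n -> R}) :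
    nat -> nat -> R :=
  fun i j =>
    \sum_(e : edge n | (tail e == i :> nat) && (head e == j :> nat)) f e.

Lemma tail_lt_head (n : nat) (e : edge n) : (tail e < head e)%N.
Proof. exact: (valP e). Qed.

Lemma edge_eqP (n : nat) (e e' : edge n) :
  tail e = tail e' -> head e = head e' -> e = e'.
Proof.
by case: e e' => [[i j] ij] [[k l] kl]; rewrite /tail /head /= => ik jl;
  apply/val_inj; rewrite /= ik jl.
Qed.

Lemma edge_exists (n : nat) (i j : 'I_n.+1) :
  (i < j)%N -> exists e : edge n, tail e = i /\ head e = j.
Proof.
move=> ij; pose lt_pair (e : 'I_n.+1 * 'I_n.+1) := (e.1 < e.2)%N.
by exists (exist lt_pair (i, j) ij : edge n).
Qed.

Lemma sum_edge_at (R : realType) (n : nat) (F : nat -> nat -> R)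
    (i j : 'I_n.+1) :
  (forall i j, ~~ (i < j <= n)%N -> F i j = 0) ->
  \sum_(e : edge n | (tail e == i) && (head e == j)) F (tail e) (head e) =
  F i j.
Proof.
move=> F1; have [ij|ji] := ltnP i j.
  have [e [ei ej]] := edge_exists ij.
  rewrite (big_pred1 e) ?ei ?ej // => e'; rewrite -ei -ej.
  apply/andP/eqP => [[/eqP ? /eqP ?]|->]; [exact: edge_eqP|by rewrite !eqxx].
rewrite big_pred0 => [|e].
  by rewrite F1 // ltnNge ji.
apply/negP => /andP[/eqP ei /eqP ej].
by have := tail_lt_head e; rewrite ei ej ltnNge ji.
Qed.

Lemma sum_restrict_tail (R : realType) (n : nat) (F : nat -> nat -> R)
    (i : 'I_n.+1) :
  (forall i j, ~~ (i < j <= n)%N -> F i j = 0) ->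
  \sum_(e : edge n | tail e == i) restrict n F e = \sum_(j < n.+1) F i j.
Proof.
move=> F1; rewrite (partition_big (@head n) xpredT) //=.
apply: eq_bigr => j _; rewrite -sum_edge_at //.
by apply: eq_bigr => e _; rewrite ffunE.
Qed.

Lemma sum_restrict_head (R : realType) (n : nat) (F : nat -> nat -> R)
    (j : 'I_n.+1) :
  (forall i j, ~~ (i < j <= n)%N -> F i j = 0) ->
  \sum_(e : edge n | head e == j) restrict n F e = \sum_(i < n.+1) F i j.
Proof.
move=> F1; rewrite (partition_big (@tail n) xpredT) //=.
apply: eq_bigr => i _; rewrite -sum_edge_at //.
by apply: eq_big => [e|e _]; rewrite ?ffunE // andbC.
Qed.

Lemma extendE (R : realType) (n : nat) (f : {ffun edge n -> R}) (e : edge n) :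
  extend f (tail e) (head e) = f e.
Proof.
by rewrite /extend (big_pred1 e).
Qed.

Lemma extend_out (R : realType) (n : nat) (f : {ffun edge n -> R}) i j :
  ~~ (i < j <= n)%N -> extend f i j = 0.
Proof.
move=> ij; rewrite /extend big_pred0 // => e.
apply/negP => /andP[/eqP ei /eqP ej].
have := tail_lt_head e; have := ltn_ord (head e).
by move: ij; rewrite -ei -ej; lia.
Qed.

Lemma extend_neq0 (R : realType) (n : nat) (f : {ffun edge n -> R}) i j :
  extend f i j != 0 ->
  exists e, [/\ tail e = i :> nat, head e = j :> nat & f e != 0].
Proof.
have [ij|/(extend_out f) ->] := boolP (i < j <= n)%N; last by rewrite eqxx.
have iN : (i < n.+1)%N by lia.
have jN : (j < n.+1)%N by lia.
have [|e [ei ej]] := @edge_exists n (Ordinal iN) (Ordinal jN).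
  by case/andP: ij.
have -> : i = tail e by rewrite ei.
have -> : j = head e by rewrite ej.
by rewrite extendE => fe; exists e.
Qed.

Lemma restrictK (R : realType) (n : nat) (f : {ffun edge n -> R}) :
  restrict n (extend f) = f.
Proof. by apply/ffunP => e; rewrite ffunE extendE. Qed.

Lemma restrict_tree_flow (R : realType) (n : nat) (a : 'I_n.+1 -> int)
    (b : nat -> R) (F : nat -> nat -> R) :
  (forall i : 'I_n.+1, (a i)%:~R = b i) -> tree_flow n b F ->
  flow_polytope R a (restrict n F) /\ nonbranching (restrict n F).
Proof.
move=> ab [F0 F1 F2 F3]; split; first split.
- by move=> e; rewrite ffunE.
- move=> i; rewrite sum_restrict_tail // sum_restrict_head // ab.
  by apply: F2; rewrite -ltnS.
- move=> e e'; rewrite !ffunE => fe fe' ee'; rewrite -ee' in fe'.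
  by apply: edge_eqP => //; apply/val_inj; exact: F3 fe fe'.
Qed.

Lemma extend_tree_flow (R : realType) (n : nat) (a : 'I_n.+1 -> int)
    (b : nat -> R) (f : {ffun edge n -> R}) :
  (forall i : 'I_n.+1, (a i)%:~R = b i) ->
  flow_polytope R a f -> nonbranching f -> tree_flow n b (extend f).
Proof.
move=> ab [f0 f1] f2; split.
- by move=> i j; apply: sumr_ge0 => e _.
- exact: extend_out.
- move=> i iN; have := f1 (Ordinal (iN : (i < n.+1)%N)).
  rewrite -{1 2}(restrictK f) sum_restrict_tail; last exact: extend_out.
  rewrite sum_restrict_head; last exact: extend_out.
  by rewrite ab.
- move=> i j k /extend_neq0[e [ei ej fe]] /extend_neq0[e' [ei' ek fe']].
  rewrite -ej -ek (f2 _ _ fe fe') //; apply/val_inj; by rewrite /= ei ei'.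
Qed.

Lemma restrict_inj (R : realType) (n : nat) (b : nat -> R)
    (F G : nat -> nat -> R) :
  tree_flow n b F -> tree_flow n b G -> restrict n F = restrict n G -> F = G.
Proof.
move=> [_ F1 _ _] [_ G1 _ _] FG; apply/funext => i; apply/funext => j.
have [ij|ij] := boolP (i < j <= n)%N; last by rewrite F1 ?G1.
have iN : (i < n.+1)%N by lia.
have jN : (j < n.+1)%N by lia.
have [|e [ei ej]] := @edge_exists n (Ordinal iN) (Ordinal jN).
  by case/andP: ij.
have -> : i = tail e by rewrite ei.
have -> : j = head e by rewrite ej.
by have := congr1 (fun h : {ffun edge n -> R} => h e) FG; rewrite !ffunE.
Qed.

(** * Vertices are the nonbranching flows *)

(** Strong induction on the tail: the inflow of a vertex comes from edges with smaller tails, and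
    its whole outflow lies on a single edge of [S]. *)
Lemma nonbranching_support_inj (R : realType) (n : nat) (a : 'I_n.+1 -> int)
    (S : pred (edge n)) (x y : {ffun edge n -> R}) :
  (forall e e', S e -> S e' -> tail e = tail e' -> e = e') ->
  (forall e, ~~ S e -> x e = 0) -> (forall e, ~~ S e -> y e = 0) ->
  flow_polytope R a x -> flow_polytope R a y -> x = y.
Proof.
move=> Sinj x0 y0 [_ x1] [_ y1]; apply/ffunP => e.
have [m] := ubnP (tail e); elim: m e => // m IHm e em.
have [Se|Se] := boolP (S e); last by rewrite x0 ?y0.
have out z : (forall e, ~~ S e -> z e = 0) ->
    \sum_(e' : edge n | tail e' == tail e) z e' = z e :> R.
  move=> z0; rewrite (bigD1 e) //= big1 ?addr0 // => e' /andP[/eqP ee' ne].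
  by apply: z0; apply: contra ne => Se'; apply/eqP/Sinj.
rewrite -(out x x0) -(out y y0) -x1 -y1; congr (_ + _).
apply: eq_bigr => e' /eqP he'; apply: IHm.
by have := tail_lt_head e'; rewrite he'; lia.
Qed.

(* Maximising minus the total flow off the support of [f] cuts out the flows
   supported inside the support of [f]. *)
Lemma nonbranching_vertex (R : realType) (n : nat) (a : 'I_n.+1 -> int)
    (f : {ffun edge n -> R}) :
  flow_polytope R a f -> nonbranching f -> vertices (flow_polytope R a) f.
Proof.
move=> Pf f_nb; pose c : {ffun edge n -> R} := [ffun e => - (f e == 0)%:R].
exists c, 0.
have dotE (x : {ffun edge n -> R}) :
    dot c x = - \sum_(e : edge n | f e == 0) x e.
  rewrite /dot -sumrN [RHS]big_mkcond /=; apply: eq_bigr => e _.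
  by rewrite ffunE; case: ifP; rewrite ?mulN1r ?oppr0 ?mul0r.
split=> [x [x0 _]|]; first by rewrite dotE oppr_le0 sumr_ge0.
apply/seteqP; split => [x -> |x [Px]] /=.
  by split=> //; rewrite dotE big1 ?oppr0 // => e /eqP.
rewrite dotE => /eqP; rewrite oppr_eq0 => /eqP x_supp.
apply: (@nonbranching_support_inj _ _ a (fun e => f e != 0)) => //.
- move=> e; rewrite negbK => fe.
  by case: (Px) => x0 _; apply: (psumr_eq0P _ x_supp).
- by move=> e; rewrite negbK => /eqP.
Qed.

(** [h] is the indicator of a path in the support of [f] that starts with [e] and ends at the sink.
    Its values on tails up to [tail e] tell apart the paths of two edges with a common tail. *)
Lemma edge_flow_to_sink (R : realType) (n : nat) (a : 'I_n.+1 -> int)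
    (f : {ffun edge n -> R}) (e : edge n) :
  (forall i, i != ord_max -> 0 <= a i) -> flow_polytope R a f -> f e != 0 ->
  exists h : {ffun edge n -> R},
    [/\ forall e', f e' = 0 -> h e' = 0,
        forall e', (tail e' <= tail e)%N -> h e' = (e' == e)%:R
      & forall i, \sum_(e' : edge n | tail e' == i) h e' -
          \sum_(e' : edge n | head e' == i) h e' =
          (i == tail e)%:R - (i == ord_max)%:R].
Proof.
move=> a0 [f0 f1]; have [m] := ubnP (n - tail e); elim: m e => // m IHm e em fe.
have delta (Q : pred (edge n)) :
    \sum_(e' : edge n | Q e') ((e' == e)%:R : R) = (Q e)%:R.
  rewrite big_mkcond /= (bigD1 e) //= eqxx big1 ?addr0 => [|e' /negPf ->].
    by case: (Q e).
  by rewrite if_same.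
have delta0 e' : f e' = 0 -> (e' == e)%:R = 0 :> R.
  by move=> fe'; case: eqP => // ee'; rewrite -ee' fe' eqxx in fe.
have [he|he] := eqVneq (head e) ord_max.
  exists [ffun e' => (e' == e)%:R]; split=> [e'|e' _|i]; rewrite ?ffunE //.
    exact: delta0.
  under eq_bigr do rewrite ffunE.
  under [X in _ - X]eq_bigr do rewrite ffunE.
  by rewrite !delta he !(eq_sym i).
(* The head of [e] receives a positive amount and has nonnegative supply, so some support edge
   leaves it. *)
have [e2 e2e fe2] : exists2 e2 : edge n, tail e2 = head e & f e2 != 0.
  have : \sum_(e2 : edge n | tail e2 == head e) f e2 != 0.
    rewrite -f1 (bigD1 e) //= gt_eqF // -addrA ltr_pwDl //.
      by rewrite lt_neqAle eq_sym fe f0.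
    by rewrite addr_ge0 ?sumr_ge0 // ler0z a0.
  rewrite psumr_neq0 // => /hasP[e2 _ /andP[/eqP e2e fe2]].
  by exists e2 => //; rewrite gt_eqF.
have tlh := tail_lt_head e.
have [|h [h0 h1 h2]] := IHm e2 _ fe2.
  by have := ltn_ord (head e); rewrite e2e; lia.
exists [ffun e' => (e' == e)%:R + h e']; split=> [e' fe'|e' e'v|i].
- by rewrite ffunE h0 // delta0 // addr0.
- rewrite ffunE h1; last by rewrite e2e; lia.
  case: (e' =P e2) => [ee2|_]; last by rewrite addr0.
  by move: e'v; rewrite ee2 e2e leqNgt tlh.
have sumE (Q : pred (edge n)) :
    \sum_(e' : edge n | Q e') [ffun e' => (e' == e)%:R + h e'] e' =
    (Q e)%:R + \sum_(e' : edge n | Q e') h e'.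
  by rewrite -delta -big_split /=; apply: eq_bigr => e' _; rewrite ffunE.
rewrite !sumE; have := h2 i; rewrite e2e !(eq_sym i) => h2i.
by rewrite opprD addrACA h2i addrA subrK.
Qed.

(* Two support edges leaving the same vertex extend to two flows to the sink
   inside the support of [f]; their difference [h] is a nonzero circulation,
   and [f + eps h] and [f - eps h] both stay in the polytope. *)
Lemma vertex_nonbranching (R : realType) (n : nat) (a : 'I_n.+1 -> int)
    (f : {ffun edge n -> R}) :
  (forall i, i != ord_max -> 0 <= a i) ->
  vertices (flow_polytope R a) f -> nonbranching f.
Proof.
move=> a0 [c [b [cb fE]]].
have [Pf cf] : flow_polytope R a f /\ dot c f = b.
  by have : [set f] f by []; rewrite fE.
have f_uniq x : flow_polytope R a x -> dot c x = b -> x = f.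
  by move=> Px cx; have : [set f] x by rewrite fE.
move=> e e' fe fe' ee'; apply/eqP/negPn/negP => ne.
have [g [g0 g1 g2]] := edge_flow_to_sink a0 Pf fe.
have [g' [g0' g1' g2']] := edge_flow_to_sink a0 Pf fe'.
pose h e := g e - g' e.
have h_e : h e = 1.
  by rewrite /h g1 // g1' ?ee' // eqxx (negPf ne) subr0.
have h0 e'' : f e'' = 0 -> h e'' = 0.
  by move=> fe''; rewrite /h g0 // g0' // subrr.
(* Both unit flows run from the same vertex to the sink, so their divergences cancel. *)
have h_div i : \sum_(e : edge n | tail e == i) h e =
               \sum_(e : edge n | head e == i) h e.
  rewrite /h !sumrB; have := g2 i; have := g2' i; rewrite ee'; lra.
case: (Pf) => f0 f1.
(* The inverse of a sum dominating every ratio [|h e| / f e] works for all edges at once; the 1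
   keeps it positive. Where [f] vanishes, so does [h]. *)
pose eps := (1 + \sum_(e : edge n) `|h e| / f e)^-1.
have ratio_ge0 (e0 : edge n) : 0 <= `|h e0| / f e0.
  by rewrite divr_ge0.
have eps_gt0 : 0 < eps.
  by rewrite invr_gt0 ltr_wpDr // sumr_ge0.
have eps_le e0 : eps * `|h e0| <= f e0.
  have [fe0|fe0] := eqVneq (f e0) 0; first by rewrite fe0 h0 // normr0 mulr0.
  have fe0_gt0 : 0 < f e0 by rewrite lt_neqAle eq_sym fe0 f0.
  rewrite mulrC ler_pdivrMr; last by rewrite ltr_wpDr // sumr_ge0.
  rewrite mulrC -ler_pdivrMr // (bigD1 e0) //= addrCA lerDl.
  by rewrite addr_ge0 // sumr_ge0.
pose x t : {ffun edge n -> R} := [ffun e => f e + t * h e].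
have sum_x t (Q : pred (edge n)) : \sum_(e : edge n | Q e) x t e =
    \sum_(e : edge n | Q e) f e + t * \sum_(e : edge n | Q e) h e.
  by rewrite mulr_sumr -big_split; apply: eq_bigr => e0 _; rewrite ffunE.
have Px t : `|t| = eps -> flow_polytope R a (x t).
  move=> t_eps; split=> [e0|i]; last by rewrite !sum_x addrAC f1 h_div.
  rewrite ffunE; have := eps_le e0; rewrite -t_eps -normrM.
  by have := ler_norm (- (t * h e0)); rewrite normrN; lra.
have dot_x t : dot c (x t) = b + t * \sum_(e : edge n) c e * h e.
  rewrite -cf /dot mulr_sumr -big_split /=; apply: eq_bigr => e0 _.
  by rewrite ffunE; ring.
have Pplus : flow_polytope R a (x eps) by apply: Px; rewrite gtr0_norm.
have Pminus : flow_polytope R a (x (- eps)).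
  by apply: Px; rewrite normrN gtr0_norm.
(* Both signs of [eps] respect the bound [b], so [dot c] is constant along [h]. Then [x eps] lies on
   the face, hence equals [f], against [h e = 1]. *)
have := cb _ Pplus; have := cb _ Pminus; rewrite !dot_x => c_le c_ge.
have /(congr1 (fun y : {ffun edge n -> R} => y e)) : x eps = f.
  by apply: f_uniq => //; rewrite dot_x; lra.
by rewrite ffunE h_e mulr1; lra.
Qed.

(** * The number of vertices *)

Lemma mem_vertices (R : realType) (n : nat) (a : 'I_n.+1 -> int)
    (b : nat -> R) (f : {ffun edge n -> R}) :
  (forall i : 'I_n.+1, (a i)%:~R = b i) ->
  (forall i, i != ord_max -> 0 <= a i) ->
  vertices (flow_polytope R a) f <->
  exists2 F, tree_flow n b F & f = restrict n F.
Proof.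
move=> ab a0; split=> [fV|[F FF ->]]; last first.
  have [PF F_nb] := restrict_tree_flow ab FF.
  exact: nonbranching_vertex.
have f_nb := vertex_nonbranching a0 fV.
have Pf : flow_polytope R a f.
  by case: fV => c [d [_ fE]]; have : [set f] f by []; rewrite fE => -[].
by exists (extend f); [exact: extend_tree_flow|rewrite restrictK].
Qed.

(** The enumeration has no repetition, and [restrict] creates none, because tree flows vanish off
    the edges. *)
Lemma card_vertices (R : realType) (n : nat) (a : 'I_n.+1 -> int)
    (b : nat -> R) :
  (forall i : 'I_n.+1, (a i)%:~R = b i) ->
  (forall i, i != ord_max -> 0 <= a i) -> \sum_i a i = 0 ->
  vertices (flow_polytope R a) #= `I_(size (enum_flows n b)).
Proof.
move=> ab a0 a_sum.
have enumP F : F \in enum_flows n b <-> tree_flow n b F.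
  apply: mem_enum_flows => [i iN|].
    have iN1 : (i < n.+1)%N by lia.
    by rewrite -(ab (Ordinal iN1)) ler0z a0 // -val_eqE /= ltn_eqF.
  by under eq_bigr do rewrite -ab; rewrite -rmorph_sum /= a_sum.
pose fs := [seq restrict n F | F <- enum_flows n b].
have fs_uniq : uniq fs.
  rewrite map_inj_in_uniq ?uniq_enum_flows // => F G /enumP FF /enumP GG.
  exact: restrict_inj FF GG.
have -> : vertices (flow_polytope R a) = [set` seq_fset tt fs].
  apply/seteqP; split=> f.
    rewrite -[X in _ -> X]/(is_true (f \in seq_fset tt fs)) seq_fsetE.
    move=> /(mem_vertices f ab a0)[F /enumP FF ->]; exact: map_f.
  rewrite -[X in X -> _]/(is_true (f \in seq_fset tt fs)) seq_fsetE.
  move=> /mapP[F /enumP FF ->].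
  by apply/(mem_vertices _ ab a0); exists F.
apply/card_eq_fsetP.
by rewrite size_seq_fset undup_id // size_map.
Qed.

Theorem theorem6p3 (R : realType) (r s : nat) :
  vertices (flow_polytope R (netflow r s))
  #= `I_(2 ^ r.+1 * 3 ^ s)%N.
Proof.
pose b i : R := (nth 0 (netflow_seq r s) i)%:~R.
have netflowE i : (i < r + s + 2)%N ->
    nth 0 (netflow_seq r s) i = ((i == 0%N) || (i == r.+1))%:R :> int.
  case: i => [|i] // iN; rewrite /netflow_seq /= nth_cat size_nseq eqSS.
  rewrite nth_nseq.
  have [ir|ri] := ltnP i r; first by rewrite ltn_eqF.
  have -> : (i == r) = (i - r == 0)%N by lia.
  have : (i - r <= s)%N by lia.
  case: (i - r)%N => [|k] //= ks.
  by rewrite nth_cat size_nseq nth_nseq ks.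
have -> : (2 ^ r.+1 * 3 ^ s)%N = size (enum_flows (r + s + 2) b).
  (* The two supplies differ only at the sink, where the net flow is -2. The sink is [r + s + 2],
     which leaves [s] vertices after the source [r.+1]. *)
  rewrite (@eq_enum_flows _ _ _ (two_supply 0 r.+1 1 1)) => [|i iN]; last first.
    rewrite /b netflowE // /two_supply /point_supply.
    by case: i {iN} => [|i]; rewrite /= ?addr0 ?add0r //; case: eqP.
  rewrite size_enum_two //; last by lia.
  by congr (_ * 3 ^ _)%N; lia.
apply: card_vertices => [//|i|]; last exact: sum_netflow.
rewrite -val_eqE /= => iN; rewrite /netflow netflowE ?ler0n //.
by rewrite ltn_neqAle iN -ltnS ltn_ord.
Qed.
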